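(* Let $n\ge 2$ and fix a real number $x_n>0$. For $\xi=(\xi^1,\dots,\xi^{n-1})\in\Xi=\{\xi\in\mathbb{R}^{n-1} : \xi^i>0 \text{ for all } i,\ \sum_{i=1}^{n-1}\xi^i<1\}$ put $p_i=\xi^i$ for $1\le i\le n-1$ and $p_n=1-\sum_{i=1}^{n-1}\xi^i$, and let $\varphi(\xi)$ be the negative multinomial distribution on $\mathbb{N}^{n-1}$ with probability mass function $$p(x_1,\dots,x_{n-1};\xi)=p_n^{x_n}\,\frac{\Gamma\left(\sum_{i=1}^{n}x_i\right)}{\Gamma(x_n)}\prod_{i=1}^{n-1}\frac{p_i^{x_i}}{x_i!}.$$ Let $\mathcal{S}=\varphi(\Xi)$ be the corresponding statistical manifold, equipped with the Fisher metric $g$. Let $S^{n-1}_{2,+}=\{(y_1,\dots,y_n)\in\mathbb{R}^n : y_i>0 \text{ for all } i,\ \sum_{i=1}^n y_i^2=4\}$ be equipped with the restriction of the hyperbolic metric of the half-space $\mathcal{H}^n$. Then the diffeomorphism $$f:\mathcal{S}\to S^{n-1}_{2,+},\qquad f(\varphi(\xi))=(2\sqrt{p_1},\dots,2\sqrt{p_n}),$$ is an isometry up to the factor $4x_n$; that is, for every $p=\varphi(\xi)\in\mathcal{S}$ and all $u,v\in T_p\mathcal{S}$, $$g_p(u,v)=4x_n\,\big\langle \mathrm{d}f_p(u),\mathrm{d}f_p(v)\big\rangle_{\mathcal{H}^n,\,f(p)}.$$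
   Context: $\mathbb{N}=\{0,1,2,\dots\}$. For a parametric family $p_\xi=p(x;\xi)$ of densities (or mass functions) with respect to a measure $\mu$ on a sample space $\mathcal{X}$, parametrised by $\xi$ in an open subset $\Xi$ of $\mathbb{R}^d$, the Fisher matrix is $G(\xi)=[g_{ij}(\xi)]$ with $g_{ij}(\xi)=\int_{\mathcal{X}}p_\xi\,\frac{\partial\log p_\xi}{\partial\xi^i}\,\frac{\partial\log p_\xi}{\partial\xi^j}\,\mathrm{d}\mu$ (for discrete $\mathcal{X}$, $\mu$ is counting measure). The Fisher metric on the statistical manifold $\mathcal{S}=\{p_\xi\}$, with global parametrisation $\varphi:\xi\mapsto p_\xi$, is the Riemannian metric with $g_{p_\xi}(\mathrm{d}\varphi_\xi(a),\mathrm{d}\varphi_\xi(b))=a^{\mathsf T}G(\xi)b$ for $a,b\in\mathbb{R}^d$. The hyperbolic half-space is $\mathcal{H}^n=\{(y_1,\dots,y_n)\in\mathbb{R}^n : y_n>0\}$ with the Riemannian metric $\langle u,v\rangle_{\mathcal{H}^n,\,y}=\frac{1}{y_n^2}\sum_{i=1}^n u_iv_i$ at the point $y$. *)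

(* Defs.v *)
From HB Require Import structures.
From mathcomp Require Import all_boot all_order all_algebra.
From mathcomp Require Import all_classical all_reals all_analysis.
Set Implicit Arguments.
Unset Strict Implicit.
Unset Printing Implicit Defensive.
Import Order.TTheory GRing.Theory Num.Theory.
Import numFieldNormedType.Exports.
Local Open Scope classical_set_scope.
Local Open Scope ring_scope.

Section Smooth.
Context {R : realType} {V W : normedModType R}.

Fixpoint iter_derive (s : seq V) (h : V -> W) : V -> W :=
  if s is v :: s' then iter_derive s' (fun x => 'D_v h x) else h.

(* C^oo on U; only meaningful for open U. *)
Definition smooth_on_open (U : set V) (h : V -> W) : Prop :=
  forall (s : seq V) (x : V), U x -> differentiable (iter_derive s h) x.

(* Smoothness on an arbitrary subset A: local extendability to a C^oo map.
   On an embedded submanifold A this is smoothness in the manifold sense. *)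
Definition smooth_on (A : set V) (h : V -> W) : Prop :=
  forall x, A x -> exists (U : set V) (h' : V -> W),
    [/\ open U, U x, smooth_on_open U h' &
        forall z, A z -> U z -> h z = h' z].

End Smooth.

(* A family [p] of densities on [X] with respect to [mu], with parameter in a
   subset [Xi] of R^k. A distribution is identified with its density, so the
   manifold is a subset of [X -> R], and its tangent vectors are the velocities
   of families of densities, taken pointwise on [X]. *)
Section StatisticalManifold.
Context {R : realType} {d : measure_display} {X : measurableType d}.
Variable mu : {measure set X -> \bar R}.
Context {k : nat}.
Variables (Xi : set 'rV[R]_k) (p : 'rV[R]_k -> X -> R).

Definition score (xi : 'rV[R]_k) (i : 'I_k) (x : X) : R :=
  'D_(delta_mx 0 i) (fun xi' : 'rV[R]_k => ln (p xi' x)) xi.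

Definition fisher_integrand (xi : 'rV[R]_k) (i j : 'I_k) (x : X) : R :=
  p xi x * score xi i x * score xi j x.

Definition fisher_matrix (xi : 'rV[R]_k) : 'M[R]_k :=
  \matrix_(i, j) \int[mu]_x fisher_integrand xi i j x.

Definition stat_manifold : set (X -> R) := p @` Xi.

Definition dparam (xi a : 'rV[R]_k) : X -> R :=
  fun x => 'd (fun xi' : 'rV[R]_k => p xi' x) xi a.

(* What makes [p] a global parametrisation of a statistical manifold with a
   well-defined Fisher metric; in particular it guarantees that the partial
   inverses [chart] and [tangent_coord] below are genuine inverses. *)
Record stat_parametrisation : Prop := StatParametrisation {
  param_open : open Xi ;
  density_gt0 : forall xi x, Xi xi -> 0 < p xi x ;
  density_int1 : forall xi, Xi xi -> (\int[mu]_x (p xi x)%:E)%E = 1%E ;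
  param_inj : set_inj Xi p ;
  param_diff : forall xi x, Xi xi ->
    differentiable (fun xi' : 'rV[R]_k => p xi' x) xi ;
  dparam_inj : forall xi, Xi xi -> injective (dparam xi) ;
  fisher_integrable : forall xi i j, Xi xi ->
    mu.-integrable setT (EFin \o fisher_integrand xi i j) }.

Definition chart : (X -> R) -> 'rV[R]_k := 'pinv_(fun=> 0) Xi p.

Definition tangent_space (q : X -> R) : set (X -> R) :=
  range (dparam (chart q)).

Definition tangent_coord (q u : X -> R) : 'rV[R]_k :=
  'pinv_(fun=> 0) setT (dparam (chart q)) u.

Definition fisher_metric (q u v : X -> R) : R :=
  (tangent_coord q u *m fisher_matrix (chart q) *m (tangent_coord q v)^T) 0 0.

Definition tangent_map {W : normedModType R} (f : (X -> R) -> W)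
    (q u : X -> R) : W :=
  'd (f \o p) (chart q) (tangent_coord q u).

(* [f] is a diffeomorphism from the statistical manifold onto the submanifold
   [M] of [W]. As [p] is a global parametrisation, smoothness of [f] is that of
   [f \o p], and smoothness of its inverse is that of [h : M -> Xi]. *)
Definition diffeomorphism_onto {W : normedModType R} (f : (X -> R) -> W)
    (M : set W) : Prop :=
  [/\ set_bij stat_manifold M f,
      smooth_on Xi (f \o p) &
      exists h : W -> 'rV[R]_k,
        smooth_on M h /\ forall xi, Xi xi -> h (f (p xi)) = xi].

End StatisticalManifold.

Section NegativeMultinomial.
Context {R : realType}.

Definition Gamma (z : R) : R :=
  \int[lebesgue_measure]_(t in `]0, +oo[) (t `^ (z - 1) * expR (- t)).

Context {k : nat}.

Definition param_domain : set 'rV[R]_k :=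
  [set xi | (forall i, 0 < xi 0 i) /\ \sum_i xi 0 i < 1].

(* (p_1, ..., p_n) with n = k + 1 and the last index [ord_max] standing for n. *)
Definition prob (xi : 'rV[R]_k) : 'rV[R]_k.+1 :=
  \row_i if unlift ord_max i is Some j then xi 0 j else 1 - \sum_j xi 0 j.

(* [r] is the fixed real x_n, and [x] is (x_1, ..., x_{n-1}). *)
Definition negative_multinomial (r : R) (xi : 'rV[R]_k) (x : k.-tuple nat) : R :=
  prob xi 0 ord_max `^ r *
  (Gamma (\sum_i (tnth x i)%:R + r) / Gamma r) *
  \prod_i (xi 0 i ^+ tnth x i / ((tnth x i)`!)%:R).

(* The metric of the half-space {y | 0 < y_n} at y. *)
Definition hyperbolic_metric (y u v : 'rV[R]_k.+1) : R :=
  (y 0 ord_max ^+ 2)^-1 * \sum_i u 0 i * v 0 i.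

Definition positive_sphere2 : set 'rV[R]_k.+1 :=
  [set y | (forall i, 0 < y 0 i) /\ \sum_i y 0 i ^+ 2 = 4].

End NegativeMultinomial.

(* Main.v *)
Require Import Defs.
From mathcomp Require Import finmap.
From mathcomp Require Import all_boot all_order all_algebra.
From mathcomp Require Import all_classical all_reals all_analysis.
From mathcomp Require Import measurable_realfun ring lra.
Set Implicit Arguments.
Unset Strict Implicit.
Unset Printing Implicit Defensive.
Import Order.TTheory GRing.Theory Num.Theory.
Import numFieldNormedType.Exports.
Local Open Scope classical_set_scope.
Local Open Scope ring_scope.

(** The negative multinomial mass at [x] is a constant times a monomial in
    (p_1, ..., p_n) with exponents (x_1, ..., x_{n-1}, x_n), so the score in the
    direction of xi^i is x_i / xi^i - x_n / p_n.  Since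
    Gamma (x_n + 1) = x_n * Gamma x_n, multiplying the mass by x_i amounts to
    shifting x_i by one and replacing the parameter x_n by x_n + 1:
    x_i p_{x_n}(x) = (x_n xi^i / p_n) p_{x_n + 1}(x - e_i).  Hence all second
    moments follow from the normalisation of the mass function, and
    g_ij = (x_n / p_n) * (1 / p_n + delta_ij / xi^i).  This is also the
    pull-back under (2 sqrt p_1, ..., 2 sqrt p_n) of 4 x_n times the Euclidean
    metric divided by y_n^2 = 4 p_n. *)

(** * The Gamma integral *)

Section GammaIntegral.
Context {R : realType}.
Local Notation mu := (@lebesgue_measure R).

(** Lebesgue measure is [c] times its image under multiplication by [c]: the two agree on half-open
    intervals, hence everywhere by uniqueness. Since [c] is positive, the half-line is its own
    preimage. *)
Lemma ge0_integral_0y_scale (c : R) (f : R -> \bar R) :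
  0 < c -> measurable_fun [set: measurableTypeR R] f -> (forall t, (0 <= f t)%E) ->
  (\int[mu]_(t in `]0%R, +oo[) f t =
   c%:E * \int[mu]_(t in `]0%R, +oo[) f (c * t)%R)%E.
Proof.
move=> c0 mf f0.
pose phi := (fun t => c * t) : measurableTypeR R -> measurableTypeR R.
have mphi : measurable_fun setT phi by exact: measurable_funM.
pose nu := mscale (NngNum (ltW c0)) (pushforward mu phi).
have nuE A : measurable A -> mu A = nu mphi A.
  apply: lebesgue_measure_unique => _ [[a b] _ <-].
  change (mu `]a, b] = c%:E * mu (phi @^-1` `]a, b]))%E.
  have -> : phi @^-1` `]a, b] = `]a / c, b / c]%classic.
    apply/seteqP; split=> t; rewrite /phi /= !in_itv/=;
    by rewrite ltr_pdivrMr// ler_pdivlMr// mulrC.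
  rewrite !lebesgue_measure_itv/= !lte_fin ltr_pM2r ?invr_gt0//.
  case: ifP => _; last by rewrite mule0.
  by rewrite -EFinB -EFinM -mulrBl mulrCA divff ?gt_eqF// mulr1.
transitivity (\int[nu mphi]_(t in `]0%R, +oo[) f t)%E.
  by apply: eq_measure_integral => A mA _; exact: nuE.
have mf' : measurable_fun (`]0%R, +oo[ : set (measurableTypeR R)) f by exact: measurable_funTS.
rewrite ge0_integral_mscale// ge0_integral_pushforward//.
congr (_ * integral _ _ _)%E.
apply/seteqP; split=> t; rewrite /phi /= !in_itv/= !andbT pmulr_rgt0//.
Qed.

Definition gamma_density (z t : R) : R := t `^ (z - 1) * expR (- t).

Lemma gamma_density_ge0 z t : 0 <= gamma_density z t.
Proof. by rewrite mulr_ge0 ?powR_ge0 ?expR_ge0. Qed.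

Lemma measurable_gamma_density z : measurable_fun [set: measurableTypeR R] (gamma_density z).
Proof.
apply: measurable_funM; first exact: measurable_powR.
by apply: measurableT_comp => //; exact: measurable_funN.
Qed.

Lemma measurable_EFin_gamma_density z (D : set (measurableTypeR R)) :
  measurable_fun D (fun t => (gamma_density z t)%:E).
Proof.
apply/measurable_EFinP; apply: measurable_funTS. exact: measurable_gamma_density.
Qed.

(** Extended real values let the functional equation be proved before finiteness is known. *)
Definition Gamma_ereal (z : R) : \bar R :=
  (\int[mu]_(t in `]0%R, +oo[) (gamma_density z t)%:E)%E.

Lemma Gamma_fine z : Gamma z = fine (Gamma_ereal z).
Proof. by []. Qed.

Lemma Gamma_ereal_ge0 z : (0 <= Gamma_ereal z)%E.
Proof. by apply: integral_ge0 => t _; rewrite lee_fin gamma_density_ge0. Qed.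

(** Substitution of [c * t] for [t] in the Gamma integral. *)
Lemma Gamma_ereal_scale (c z : R) : 0 < c ->
  (\int[mu]_(t in `]0%R, +oo[) (t `^ (z - 1) * expR (- (c * t)))%:E =
   (c `^ (- z))%:E * Gamma_ereal z)%E.
Proof.
move=> c0.
rewrite /Gamma_ereal (ge0_integral_0y_scale c0 (@measurable_EFin_gamma_density z setT)); last first.
  by move=> t; rewrite lee_fin gamma_density_ge0.
rewrite muleA -EFinM -ge0_integralZl//; last 3 first.
- apply: measurable_funTS.
  apply: (@measurableT_comp _ _ _ _ _ _ (fun t => (gamma_density z t)%:E)).
    exact: measurable_EFin_gamma_density.
  exact: measurable_funM.
- by move=> t _; rewrite lee_fin gamma_density_ge0.
- by rewrite lee_fin mulr_ge0 ?powR_ge0// ltW.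
apply: eq_integral => t; rewrite inE/= in_itv/= andbT => t0.
rewrite -EFinM /gamma_density; congr EFin.
(* The factors come from the claim, the Jacobian and the density; their exponents add up to 0. *)
have cE : c `^ (- z) * c * c `^ (z - 1) = 1.
  have cn0 : c != 0 by rewrite gt_eqF.
  rewrite -[X in _ * X * _]powRr1 ?ltW// -!powRD ?cn0 ?implybT//.
  by rewrite (_ : _ + _ = 0) ?powRr0//; ring.
by rewrite powRM ?(ltW c0, ltW t0)// !mulrA cE mul1r.
Qed.

Lemma is_derive_expRN (t : R) : is_derive t 1 (fun s : R => expR (- s)) (- expR (- t)).
Proof.
rewrite -mulrN1; apply: (@is_derive1_comp _ expR -%R).
Qed.

(** With [b] = n + 2 and an integer m >= z, exp b >= b^(m+1) / (m+1)! bounds the term by (m+1)! / b,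
    hence by a multiple of the harmonic sequence. *)
Lemma cvg_powR_expRN_pinfty (z : R) :
  (n.+2%:R : R) `^ z * expR (- n.+2%:R) @[n --> \oo] --> (0 : R).
Proof.
have [m zm] : exists m : nat, z <= m%:R.
  by exists (Num.truncn z).+1; rewrite ltW// truncnS_gt.
have lim0 : (m.+1)`!%:R * (n.+1%:R : R)^-1 @[n --> \oo] --> (0 : R).
  rewrite -(mulr0 (m.+1)`!%:R); apply: cvgMr; exact: cvg_harmonic.
apply: (@squeeze_cvgr _ _ _ _ (fun=> 0) (fun n => (m.+1)`!%:R * (n.+1%:R : R)^-1)) => //; last exact: cvg_cst.
near=> n; rewrite mulr_ge0 ?powR_ge0 ?expR_ge0//=.
set b : R := n.+2%:R.
have b1 : 1 <= b by rewrite ler1n.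
have b0 : 0 < b by rewrite ltr0n.
have h : b ^+ m.+1 / (m.+1)`!%:R <= expR b.
  by apply: (le_trans _ (expR_ge1Dxn m (ltW b0))); rewrite lerDr.
have h2 : b `^ z <= b ^+ m by rewrite -powR_mulrn ?(ltW b0)//; exact: ler_powR.
rewrite expRN ler_pdivrMr ?expR_gt0//.
apply: (le_trans h2).
have f0 : 0 < (m.+1)`!%:R :> R by rewrite ltr0n fact_gt0.
rewrite mulrAC ler_pdivlMr ?ltr0n//.
apply: (@le_trans _ _ (b ^+ m * b)).
  by rewrite ler_wpM2l ?exprn_ge0 ?(ltW b0)// ler_nat.
by rewrite -exprSr mulrC -ler_pdivrMr.
Unshelve. all: end_near. Qed.

Lemma cvg_powR_expRN_0 (z : R) : 0 < z ->
  (n.+2%:R^-1 : R) `^ z * expR (- n.+2%:R^-1) @[n --> \oo] --> (0 : R).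
Proof.
move=> z0.
have lim0 : (n.+2%:R^-1 : R) `^ z @[n --> \oo] --> (0 : R).
  apply: (cvg_comp _ _ _ (powR_cvg0 z0)) => A [e /= e0 Ae].
  near=> n; apply: Ae; last by rewrite invr_gt0 ltr0n.
  rewrite /= sub0r normrN gtr0_norm ?invr_gt0 ?ltr0n//.
  apply: (@le_lt_trans _ _ (n.+1%:R^-1)).
    by rewrite lef_pV2 ?posrE ?ltr0n// ler_nat.
  by near: n; exact: near_infty_natSinv_lt (PosNum e0).
apply: (@squeeze_cvgr _ _ _ _ (fun=> 0) (fun n => (n.+2%:R^-1 : R) `^ z)) => //; last exact: cvg_cst.
near=> n; rewrite mulr_ge0 ?powR_ge0 ?expR_ge0//=.
by rewrite ler_piMr ?powR_ge0// expR_le1 oppr_le0 invr_ge0 ler0n.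
Unshelve. all: end_near. Qed.

(** Integration by parts of t^z against the primitive -exp(-t) of exp(-t). Staying away from 0 keeps
    t^z differentiable even when z < 1. *)
Lemma gamma_density_by_parts (a b z : R) : 0 <= z -> 0 < a -> a < b ->
  (\int[mu]_(t in `[a, b]) (gamma_density (z + 1) t)%:E =
   (a `^ z * expR (- a) - b `^ z * expR (- b))%:E +
   z%:E * \int[mu]_(t in `[a, b]) (gamma_density z t)%:E)%E.
Proof.
move=> z0 a0 ab.
have gt0 t : a <= t -> 0 < t by exact: lt_le_trans.
have cpow p : {in `[a, b]%R, continuous (fun t : R => t `^ p)}.
  move=> t; rewrite in_itv/= => /andP[/gt0 t0 _].
  apply: differentiable_continuous; apply/derivable1_diffP.
  by apply: derivable_powR; rewrite in_itv/= andbT.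
have cexp : continuous (fun t : R => expR (- t)).
  by move=> t; apply: differentiable_continuous; apply/derivable1_diffP; apply: ex_derive; exact: is_derive_expRN.
have within_cts (f : R -> R) : {in `[a, b]%R, continuous f} -> {within `[a, b], continuous f}.
  move=> cf; apply: continuous_in_subspaceT => t; rewrite inE => ?; exact: cf.
have byparts := @integration_by_parts R (fun t => t `^ z) (fun t => - expR (- t))
  (fun t => z * t `^ (z - 1)) (fun t => expR (- t)) a b ab _ _ _ _ _ _.
rewrite [LHS](_ : _ = \int[mu]_(t in `[a, b]) (t `^ z * expR (- t))%:E)%E; last first.
  by apply: eq_integral => t _; rewrite /gamma_density addrK.
rewrite byparts.
- rewrite -ge0_integralZl//; last 2 first.
  + exact: measurable_EFin_gamma_density.
  + by move=> t _; rewrite lee_fin gamma_density_ge0.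
  rewrite !mulrN opprK (addrC (- (b `^ z * expR (- b)))).
  congr (_ + _)%E.
  rewrite [X in (- X)%E](_ : _ = \int[mu]_(t in `[a, b]) (- (z%:E * (gamma_density z t)%:E)))%E; last first.
    by apply: eq_integral => t _; rewrite -EFinM -EFinN /gamma_density mulrN mulrA.
  rewrite integral_ge0N ?oppeK// => t _.
  by rewrite mule_ge0// lee_fin// gamma_density_ge0.
- apply: within_cts => t tab; apply: cvgM; first exact: cvg_cst.
  exact: cpow.
- split.
  + move=> t; rewrite in_itv/= => /andP[/ltW/gt0 t0 _].
    by apply: derivable_powR; rewrite in_itv/= andbT.
  + by apply: cvg_at_right_filter; apply: cpow; rewrite in_itv/= lexx ltW.
  + by apply: cvg_at_left_filter; apply: cpow; rewrite in_itv/= lexx ltW.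
- move=> t; rewrite in_itv/= => /andP[/ltW/gt0 t0 _].
  by rewrite powR_derive1// in_itv/= andbT.
- by apply: within_cts => t _; exact: cexp.
- split.
  + by move=> t _; apply: derivableN; apply: ex_derive; exact: is_derive_expRN.
  + by apply: cvg_at_right_filter; apply: cvgN; exact: cexp.
  + by apply: cvg_at_left_filter; apply: cvgN; exact: cexp.
- move=> t _; rewrite derive1E deriveN; last by apply: ex_derive; exact: is_derive_expRN.
  by rewrite (@derive_val _ _ _ _ _ _ _ (is_derive_expRN t)) opprK.
Qed.

(** Compact intervals exhausting the open half-line. Taking n + 2 keeps the endpoints distinct at n
    = 0, as integration by parts requires. *)
Let E (n : nat) : set (measurableTypeR R) := `[n.+2%:R^-1, n.+2%:R]%classic.

Let nondecreasing_E : nondecreasing_seq E.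
Proof.
move=> m n mn; rewrite subsetEset => t; rewrite /E /= !in_itv/= => /andP[mt tm].
rewrite (le_trans _ mt) ?(le_trans tm) ?ler_nat//.
by rewrite lef_pV2 ?posrE ?ltr0n// ler_nat.
Qed.

Let bigcup_E : \bigcup_n E n = `]0%R, +oo[%classic.
Proof.
apply/seteqP; split=> t.
  move=> [n _]; rewrite /E /= !in_itv/= andbT => /andP[+ _].
  by apply: lt_le_trans; rewrite invr_gt0 ltr0n.
rewrite /= in_itv/= andbT => t0.
(* The sum of t and 1/t dominates both, so one index serves both endpoints. *)
exists (Num.truncn (t + t^-1)) => //; rewrite /E/= in_itv/=.
have h := ltW (truncnS_gt (t + t^-1)).
have h2 : t + t^-1 <= (Num.truncn (t + t^-1)).+2%:R.
  by apply: (le_trans h); rewrite ler_nat.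
apply/andP; split; last by apply: le_trans h2; rewrite lerDl invr_ge0 ltW.
rewrite -[leRHS]invrK lef_pV2 ?posrE ?ltr0n ?invr_gt0//.
by apply: le_trans h2; rewrite lerDr ltW.
Qed.

Let cvg_integral_E (z : R) :
  (\int[mu]_(t in E n) (gamma_density z t)%:E)%E @[n --> \oo] --> Gamma_ereal z.
Proof.
rewrite /Gamma_ereal -bigcup_E.
apply: ge0_nondecreasing_set_cvg_integral => //.
- by move=> n; exact: measurable_itv.
- by move=> n; exact: measurable_EFin_gamma_density.
- by move=> n t _; rewrite lee_fin gamma_density_ge0.
Qed.

(** Limit of the integration by parts on [E n]: the boundary terms vanish at both ends and the
    integrals converge monotonically. *)
Lemma Gamma_erealD1 (z : R) : 0 < z ->
  (Gamma_ereal (z + 1) = z%:E * Gamma_ereal z)%E.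
Proof.
move=> z0; rewrite -(cvg_lim _ (@cvg_integral_E (z + 1)))//; apply/cvg_lim => //.
have E2 n : (n.+2%:R^-1 : R) < n.+2%:R.
  by rewrite (@lt_trans _ _ 1)// ?invf_lt1 ?ltr1n ?ltr0n.
under eq_fun do rewrite gamma_density_by_parts ?invr_gt0 ?ltr0n ?(ltW z0)//.
rewrite -(add0e (_ * _)%E); apply: cvgeD.
- by rewrite fin_num_adde_defr.
- apply: cvg_EFin; first exact: nearW.
  rewrite /= -[X in _ --> X](subr0 0).
  by apply: cvgB; [exact: cvg_powR_expRN_0|exact: cvg_powR_expRN_pinfty].
- by apply: cvgeZl => //; exact: cvg_integral_E.
Qed.

(** This is the total mass of the exponential distribution of rate 1; the endpoint 0 is
    negligible. *)
Lemma Gamma_ereal1 : Gamma_ereal 1 = 1%E.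
Proof.
have := integral_exponential_pdf (@ltr01 R).
rewrite /Gamma_ereal => <-.
transitivity (\int[mu]_(t in `[0%R, +oo[) (expR (- t))%:E)%E.
  rewrite -integral_itv_obnd_cbnd.
    apply: eq_integral => t _.
    by rewrite /gamma_density subrr powRr0 mul1r.
  apply: measurable_funTS; apply/measurable_EFinP.
  by apply: measurableT_comp => //; exact: measurable_funN.
rewrite integral_mkcond; apply: eq_integral => t _.
rewrite /exponential_pdf !patchE; case: ifP => // _.
by rewrite mulN1r mul1r.
Qed.

(** Positive integers follow from the functional equation. For p >= 1, t^(p-1) <= 1 + t^m with an
    integer m >= p - 1 reduces to integers. For other z > 0, an infinite value at z would force one
    at z + 1. *)
Lemma Gamma_ereal_lty (z : R) : 0 < z -> (Gamma_ereal z < +oo)%E.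
Proof.
have fin_nat n : (Gamma_ereal n.+1%:R < +oo)%E.
  elim: n => [|n IH]; first by rewrite Gamma_ereal1 ltry.
  by rewrite -natr1 Gamma_erealD1// lte_mul_pinfty.
have fin_ge1 p : 1 <= p -> (Gamma_ereal p < +oo)%E.
  move=> p1.
  have [m pm] : exists m : nat, p - 1 <= m%:R.
    by exists (Num.truncn (p - 1)).+1; rewrite ltW// truncnS_gt.
  apply: (@le_lt_trans _ _ (Gamma_ereal 1 + Gamma_ereal m.+1%:R)%E); last first.
    by rewrite lte_add_pinfty// Gamma_ereal1 ltry.
  rewrite /Gamma_ereal -ge0_integralD//; last 4 first.
  - by move=> t _; rewrite lee_fin gamma_density_ge0.
  - exact: measurable_EFin_gamma_density.
  - by move=> t _; rewrite lee_fin gamma_density_ge0.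
  - exact: measurable_EFin_gamma_density.
  apply: ge0_le_integral => //.
  - by move=> t _; rewrite lee_fin gamma_density_ge0.
  - exact: measurable_EFin_gamma_density.
  - by apply: emeasurable_funD; exact: measurable_EFin_gamma_density.
  move=> t; rewrite /= in_itv/= andbT => t0.
  rewrite -EFinD lee_fin /gamma_density subrr powRr0 -mulrDl.
  rewrite ler_wpM2r ?expR_ge0// -natr1 addrK.
  have [t1|/ltW t1] := leP t 1.
    rewrite (@le_trans _ _ 1)// ?lerDl ?powR_ge0//.
    have : t `^ (p - 1) <= 1 `^ (p - 1).
      by rewrite ge0_ler_powR ?nnegrE ?subr_ge0// ltW.
    by rewrite powR1.
  by rewrite (@le_trans _ _ (t `^ m%:R)) ?lerDr//; exact: ler_powR.
move=> z0; rewrite ltNge leye_eq; apply/negP => /eqP zoo.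
have := fin_ge1 (z + 1); rewrite Gamma_erealD1// zoo lerDr ltW// gt0_muley ?lte_fin//.
by move=> /(_ isT).
Qed.

Lemma Gamma_erealE (z : R) : 0 < z -> Gamma_ereal z = (Gamma z)%:E.
Proof.
move=> z0; rewrite Gamma_fine fineK// ge0_fin_numE ?Gamma_ereal_ge0//.
exact: Gamma_ereal_lty.
Qed.

Lemma GammaD1 (z : R) : 0 < z -> Gamma (z + 1) = z * Gamma z.
Proof.
move=> z0; apply: EFin_inj.
by rewrite EFinM -!Gamma_erealE ?Gamma_erealD1// addr_gt0.
Qed.

(** The density is bounded below by a positive constant on an interval of length 1. *)
Lemma Gamma_gt0 (z : R) : 0 < z -> 0 < Gamma z.
Proof.
move=> z0; rewrite -lte_fin -Gamma_erealE//.
pose D : set (measurableTypeR R) := `[1%R, 2%R]%classic.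
(* On [1, 2], 0 <= ln t <= 2, so t^(z-1) = exp((z-1) ln t) is at least the first factor. *)
pose m : R := expR (- (`|z - 1| * 2)) * expR (- 2).
apply: (@lt_le_trans _ _ (\int[mu]_(t in D) (cst m%:E) t)%E).
  have muD : mu D = 1%E.
    rewrite /D lebesgue_measure_itv/= lte_fin ltr1n -EFinB.
    by rewrite (_ : 2 - 1 = 1)//; ring.
  rewrite integral_cst; last exact: measurable_itv.
  suff -> : (m%:E * lebesgue_measure D)%E = m%:E by rewrite lte_fin mulr_gt0 ?expR_gt0.
  by rewrite muD mule1.
apply: (@le_trans _ _ (\int[mu]_(t in D) (gamma_density z t)%:E)%E).
  apply: ge0_le_integral => //.
  - exact: measurable_itv.
  - by move=> t _; rewrite /= lee_fin mulr_ge0 ?expR_ge0.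
  - exact: measurable_EFin_gamma_density.
  move=> t; rewrite /D/= in_itv/= => /andP[t1 t2]; rewrite lee_fin.
  have t0 : 0 < t by rewrite (lt_le_trans _ t1).
  rewrite /gamma_density ler_pM ?expR_ge0//; last by rewrite ler_expR lerN2.
  rewrite /powR gt_eqF// ler_expR.
  have lnt : 0 <= ln t <= 2.
    by rewrite ln_ge0//= (le_trans _ t2)// ltW// ln_sublinear.
  rewrite lerNl (le_trans (ler_norm _))// normrN normrM ler_wpM2l//.
  by rewrite ger0_norm; case/andP: lnt.
apply: ge0_subset_integral => //.
- exact: measurable_itv.
- exact: measurable_EFin_gamma_density.
- by move=> t _; rewrite lee_fin gamma_density_ge0.
- move=> t; rewrite /D/= !in_itv/= andbT => /andP[t1 _].
  by rewrite (lt_le_trans _ t1).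
Qed.

End GammaIntegral.

(** * Sums over tuples of natural numbers *)

Section CountingTuples.
Context {R : realType} {k : nat}.
Local Open Scope ereal_scope.
Implicit Types (f : k.-tuple nat -> \bar R).

(** Singletons are finite intersections of cylinders, and there are countably many tuples. *)
Lemma measurable_tuple_nat (A : set (k.-tuple nat)) : measurable A.
Proof.
have m1 (x : k.-tuple nat) : measurable [set x].
  have -> : [set x] = \bigcap_(i in [set: 'I_k]) ((@tnth _ nat ^~ i) @^-1` [set tnth x i]).
    apply/seteqP; split=> y /=; first by move=> -> i _.
    by move=> xy; apply: eq_from_tnth => i; exact: (xy i).
  apply: fin_bigcap_measurable => // i _.
  rewrite -[X in measurable X]setTI.
  exact: (@measurable_tnth _ nat).
have -> : A = \bigcup_x (if x \in A then [set x] else set0).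
  apply/seteqP; split=> x.
    by move=> Ax; exists x => //; rewrite mem_set.
  by move=> [y _]; case: ifP => // /set_mem Ay ->.
apply: countable_bigcupT_measurable => // x; by case: ifP.
Qed.

Lemma measurable_fun_tuple_nat d (T : measurableType d) (f : k.-tuple nat -> T) D :
  measurable_fun D f.
Proof. by move=> _ Y _; exact: measurable_tuple_nat. Qed.

(** Each fiber is empty or a singleton, so this partition turns integrals over tuples into
    series. *)
Let fiber (n : nat) : set (k.-tuple nat) := [set x | pickle x = n].

Let trivIset_fiber : trivIset setT fiber.
Proof. by move=> i j _ _ [x [/= <- <-]]. Qed.

Let bigcup_fiber : \bigcup_n fiber n = setT.
Proof. by apply/seteqP; split=> // x _; exists (pickle x). Qed.

Let fiberE n : fiber n = if pickle_inv n is Some x then [set x] else set0.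
Proof.
apply/seteqP; split => x; rewrite /fiber/=.
  by move=> <-; rewrite pickleK_inv.
have := @pickle_invK (k.-tuple nat) n; case: (pickle_inv n) => //= y yn ->.
exact: yn.
Qed.

(** Tuples are enumerated by their codes; a number coding no tuple contributes the default 0. *)
Lemma esum_tuple_nat_series f : (forall x, 0 <= f x) ->
  \esum_(x in setT) f x = \sum_(n <oo) oapp f 0 (pickle_inv n).
Proof.
move=> f0; rewrite -bigcup_fiber nneseries_sum_bigcup//.
apply: eq_eseriesr => n _; rewrite fiberE.
by case: (pickle_inv n) => [x|]/=; rewrite ?esum_set1// esum_set0.
Qed.

Lemma ge0_integral_counting_tuple_nat f : (forall x, 0 <= f x) ->
  \int[counting]_x f x = \esum_(x in setT) f x.
Proof.
move=> f0; rewrite esum_tuple_nat_series// -bigcup_fiber.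
rewrite ge0_integral_bigcup//; last 2 first.
- by move=> n; exact: measurable_tuple_nat.
- exact: measurable_fun_tuple_nat.
apply: eq_eseriesr => n _; rewrite fiberE.
case: (pickle_inv n) => [x|]/=; last by rewrite integral_set0.
rewrite (eq_integral (cst (f x))); last by move=> y; rewrite inE => ->.
rewrite integral_cst; last exact: measurable_tuple_nat.
rewrite -[RHS]mule1; congr (_ * _).
by rewrite /= /counting asboolT// fset_set1 cardfs1.
Qed.

Lemma esum_tuple_natZl (c : R) f : (0 <= c)%R -> (forall x, 0 <= f x) ->
  \esum_(x in setT) (c%:E * f x) = c%:E * \esum_(x in setT) f x.
Proof.
move=> c0 f0; rewrite -!ge0_integral_counting_tuple_nat//; last first.
  by move=> x; rewrite mule_ge0.
by rewrite ge0_integralZl//; exact: measurable_fun_tuple_nat.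
Qed.

(** Tonelli for a sum over tuples: enumeration by codes reduces it to exchanging an integral with a
    series of nonnegative terms. *)
Lemma esum_tuple_nat_integral d (T : measurableType d)
    (mu : {measure set T -> \bar R}) (D : set T) (g : T -> k.-tuple nat -> \bar R) :
  measurable D -> (forall x, measurable_fun D (g ^~ x)) ->
  (forall t x, D t -> 0 <= g t x) ->
  \int[mu]_(t in D) (\esum_(x in setT) g t x) =
  \esum_(x in setT) \int[mu]_(t in D) g t x.
Proof.
move=> mD mg g0.
under eq_integral => t /set_mem Dt do rewrite (esum_tuple_nat_series (fun x => g0 t x Dt)).
rewrite integral_nneseries//; last 2 first.
- by move=> n; case: (pickle_inv n).
- by move=> n t Dt; case: (pickle_inv n) => //= x; exact: g0.
rewrite esum_tuple_nat_series; last first.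
  by move=> x; apply: integral_ge0 => t Dt; exact: g0.
apply: eq_eseriesr => n _.
by case: (pickle_inv n) => //=; rewrite integral0.
Qed.

End CountingTuples.

(** * The exponential series in several variables *)

Lemma nneseries_exp_coeff {R : realType} (a : R) : 0 <= a ->
  (\sum_(n <oo) (a ^+ n / n`!%:R)%:E = (expR a)%:E)%E.
Proof.
move=> a0; rewrite /expR /series -EFin_lim /=; last exact: is_cvg_series_exp_coeff.
congr (limn _); apply/funext => n /=.
by rewrite -sumEFin.
Qed.

(** Induction on [k]: splitting off the head of the tuple gives a double sum that factors into two
    exponentials. *)
Lemma esum_prod_exp_coeff {R : realType} (k : nat) (a : 'I_k -> R) :
  (forall i, 0 <= a i) ->
  (\esum_(x in [set: k.-tuple nat]) (\prod_i (a i ^+ tnth x i / (tnth x i)`!%:R))%:E =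
   (expR (\sum_i a i))%:E)%E.
Proof.
elim: k a => [|k IH] a a0.
  rewrite big_ord0 expR0 (_ : setT = [set [tuple]]); last first.
    by apply/seteqP; split=> // x _; rewrite /= (tuple0 x).
  by rewrite esum_set1 big_ord0// lee_fin.
pose cons2 (z : nat * k.-tuple nat) : k.+1.-tuple nat := cons_tuple z.1 z.2.
have consP : set_bij ([set: nat] `*`` (fun=> [set: k.-tuple nat])) setT cons2.
  split=> //.
    move=> [n x] [m y] _ _ /(congr1 val) [-> xy]; congr pair; exact: val_inj.
  move=> x _; exists (thead x, behead_tuple x) => //.
  by rewrite /cons2/= [RHS]tuple_eta.
have c0 i n : 0 <= a i ^+ n / n`!%:R by rewrite divr_ge0// exprn_ge0.
rewrite (@reindex_esum R _ _ _ _ cons2 _ consP).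
pose F n (x : k.-tuple nat) : \bar R :=
  ((a ord0 ^+ n / n`!%:R)%:E * (\prod_i (a (lift ord0 i) ^+ tnth x i / (tnth x i)`!%:R))%:E)%E.
transitivity (\esum_(z in [set: nat] `*`` (fun=> [set: k.-tuple nat])) F z.1 z.2)%E.
  apply: eq_esum => -[n x] _ /=; rewrite /F big_ord_recl EFinM tnth0.
  by congr (_ * _%:E)%E; apply: eq_bigr => i _; rewrite tnthS.
rewrite -esum_esum; last by move=> n x _ _; rewrite /F -EFinM lee_fin mulr_ge0 ?prodr_ge0.
transitivity (\esum_(n in [set: nat])
    ((a ord0 ^+ n / n`!%:R)%:E * (expR (\sum_i a (lift ord0 i)))%:E))%E.
  apply: eq_esum => n _; rewrite /F esum_tuple_natZl//; last first.
    by move=> x; rewrite lee_fin prodr_ge0.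
  by congr (_ * _)%E; exact: (IH (fun i => a (lift ord0 i))).
rewrite -nneseries_esumT; last by move=> n; rewrite mule_ge0 ?lee_fin ?expR_ge0.
under eq_eseriesr do rewrite muleC.
rewrite nneseriesZl; last by move=> n _; rewrite lee_fin.
by rewrite nneseries_exp_coeff// big_ord_recl expRD -EFinM mulrC.
Qed.

(** * Moments of the negative multinomial distribution *)

Section NegativeMultinomialMoments.
Context {R : realType} {k : nat}.
Implicit Types (xi : 'rV[R]_k) (x : k.-tuple nat) (r : R).

Lemma prob_max xi : prob xi 0 ord_max = 1 - \sum_j xi 0 j.
Proof. by rewrite mxE unlift_none. Qed.

Lemma prob_lift xi j : prob xi 0 (lift ord_max j) = xi 0 j.
Proof. by rewrite mxE liftK. Qed.

Lemma sum_ord_lift_max (V : nmodType) (F : 'I_k.+1 -> V) :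
  \sum_i F i = F ord_max + \sum_j F (lift ord_max j).
Proof. by rewrite (bigD1_ord ord_max). Qed.

Lemma prob_gt0 xi i : param_domain xi -> 0 < prob xi 0 i.
Proof.
move=> [xi0 xi1]; have [j|] := unliftP ord_max i => ->.
  by rewrite prob_lift.
by rewrite prob_max subr_gt0.
Qed.

Lemma negative_multinomial_gt0 r xi x :
  0 < r -> param_domain xi -> 0 < negative_multinomial r xi x.
Proof.
move=> r0 Xi; rewrite /negative_multinomial !mulr_gt0 ?powR_gt0 ?prob_gt0//.
- by rewrite Gamma_gt0// ltr_wpDl// sumr_ge0.
- by rewrite invr_gt0 Gamma_gt0.
- by apply: prodr_gt0 => i _; rewrite divr_gt0 ?ltr0n ?fact_gt0// exprn_gt0//; case: Xi.
Qed.

(* Writing Gamma (|x| + r) as an integral turns the sum over x into the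
   integral of a product of exponential series. *)
Lemma esum_negative_multinomial r xi : 0 < r -> param_domain xi ->
  (\esum_(x in setT) (negative_multinomial r xi x)%:E = 1)%E.
Proof.
move=> r0 Xi; have [xi0 _] := Xi.
pose c := prob xi 0 ord_max `^ r / Gamma r.
have pn0 : 0 < prob xi 0 ord_max by exact: prob_gt0.
have c0 : 0 < c by rewrite divr_gt0 ?Gamma_gt0 ?powR_gt0.
(* The factor t^|x| of the integrand of Gamma(|x| + r) is distributed over the product, which
   becomes a term of an exponential series. *)
pose g (t : R) x := gamma_density r t * \prod_i ((t * xi 0 i) ^+ tnth x i / (tnth x i)`!%:R).
have g0 t x : 0 < t -> 0 <= g t x.
  move=> t0; rewrite mulr_ge0 ?gamma_density_ge0// prodr_ge0// => i _.
  by rewrite divr_ge0// exprn_ge0// mulr_ge0// ltW.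
have nmE x : ((negative_multinomial r xi x)%:E =
    c%:E * \int[lebesgue_measure]_(t in `]0%R, +oo[) (g t x)%:E)%E.
  have mr0 : 0 < \sum_i (tnth x i)%:R + r by rewrite ltr_wpDl// sumr_ge0.
  pose P : R := \prod_i (xi 0 i ^+ tnth x i / ((tnth x i)`!)%:R).
  have P0 : 0 <= P.
    by apply: prodr_ge0 => i _; rewrite divr_ge0// exprn_ge0// ltW.
  transitivity (c%:E * (P%:E * Gamma_ereal (\sum_i (tnth x i)%:R + r)))%E.
    rewrite Gamma_erealE// -!EFinM; congr EFin.
    by rewrite /negative_multinomial /c /P; ring.
  congr (_ * _)%E; rewrite /Gamma_ereal -ge0_integralZl//; last 2 first.
    exact: measurable_EFin_gamma_density.
    by move=> t _; rewrite lee_fin gamma_density_ge0.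
  apply: eq_integral => t; rewrite inE/= in_itv/= andbT => t0.
  rewrite -EFinM; congr EFin.
  rewrite /g /gamma_density.
  have -> : \sum_i (tnth x i)%:R + r - 1 = (\sum_i tnth x i)%:R + (r - 1) :> R.
    by rewrite natr_sum addrA.
  rewrite (@powRD _ t (\sum_i tnth x i)%:R); last by apply/implyP => _; rewrite gt_eqF.
  rewrite powR_mulrn ?ltW//.
  have -> : \prod_i ((t * xi 0 i) ^+ tnth x i / (tnth x i)`!%:R) = t ^+ (\sum_i tnth x i) * P.
    rewrite -prodrXr -big_split/=; apply: eq_bigr => i _.
    by rewrite exprMn mulrA.
  by ring.
under eq_esum do rewrite nmE.
rewrite esum_tuple_natZl ?(ltW c0)//; last first.
  by move=> x; apply: integral_ge0 => t; rewrite /= in_itv/= andbT => t0; rewrite lee_fin g0.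
rewrite -esum_tuple_nat_integral//; last 2 first.
- move=> x; apply/measurable_EFinP; apply: measurable_funTS; rewrite /g.
  apply: measurable_funM; first exact: measurable_gamma_density.
  apply: measurable_prod => i _; apply: measurable_funM => //.
  apply: measurable_funX; exact: measurable_funM.
- by move=> t x; rewrite /= in_itv/= andbT => t0; rewrite lee_fin g0.
(* Summing over x gives exp(t * sum xi), which combines with exp(-t) into exp(-p_n t); the scaled
   Gamma integral then cancels [c]. *)
transitivity (c%:E * \int[lebesgue_measure]_(t in `]0%R, +oo[)
   (t `^ (r - 1) * expR (- (prob xi 0 ord_max * t)))%:E)%E.
  congr (_ * _)%E; apply: eq_integral => t; rewrite inE/= in_itv/= andbT => t0.
  under eq_esum do rewrite /g EFinM.
  rewrite esum_tuple_natZl ?gamma_density_ge0//; last first.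
    move=> x; rewrite lee_fin prodr_ge0// => i _.
    by rewrite divr_ge0// exprn_ge0// mulr_ge0// ltW.
  rewrite (@esum_prod_exp_coeff _ _ (fun i => t * xi 0 i)); last first.
    by move=> i; rewrite mulr_ge0// ltW.
  rewrite -EFinM /gamma_density -mulrA -expRD; congr (_ * expR _)%:E.
  by rewrite prob_max -mulr_sumr; ring.
rewrite Gamma_ereal_scale// Gamma_erealE// -!EFinM /c powRN.
by congr EFin; field; rewrite !gt_eqF ?Gamma_gt0 ?powR_gt0.
Qed.

Definition incr_tnth (i : 'I_k) x : k.-tuple nat :=
  [tuple ((j == i) + tnth x j)%N | j < k].

Lemma tnth_incr i x j : tnth (incr_tnth i x) j = ((j == i) + tnth x j)%N.
Proof. by rewrite tnth_mktuple. Qed.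

(** The inverse is truncated subtraction, exact because entry [i] is positive. *)
Lemma incr_tnth_bij i :
  set_bij setT [set x : k.-tuple nat | (0 < tnth x i)%N] (incr_tnth i).
Proof.
split=> [x _|x y _ _ xy|x /= x0].
- by rewrite /= tnth_incr eqxx.
- apply: eq_from_tnth => j; apply: (@addnI (j == i)).
  by rewrite -!tnth_incr xy.
- exists [tuple (tnth x j - (j == i))%N | j < k] => //.
  apply: eq_from_tnth => j; rewrite tnth_incr tnth_mktuple.
  by case: eqP => [->|_]; rewrite ?subnKC// subn0.
Qed.

(** The factor x_i + 1 cancels against (x_i + 1)!, the argument |x| + 1 + r of Gamma is also |x| +
    (r + 1), and passing from r to r + 1 costs r in Gamma and p_n in the power. *)
Lemma negative_multinomial_incr r xi i x : 0 < r -> param_domain xi ->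
  (tnth (incr_tnth i x) i)%:R * negative_multinomial r xi (incr_tnth i x) =
  r * xi 0 i / prob xi 0 ord_max * negative_multinomial (r + 1) xi x.
Proof.
move=> r0 Xi; have pn0 : 0 < prob xi 0 ord_max by exact: prob_gt0.
have sumE : \sum_j (tnth (incr_tnth i x) j)%:R + r = \sum_j (tnth x j)%:R + (r + 1) :> R.
  under eq_bigr do rewrite tnth_incr natrD.
  rewrite big_split/= (bigD1 i)//= eqxx big1 ?addr0; last by move=> j /negbTE ->.
  by rewrite -!addrA addrC -!addrA.
rewrite /negative_multinomial sumE (GammaD1 r0) powRD; last first.
  by apply/implyP => _; rewrite gt_eqF.
rewrite powRr1 ?ltW//; set S := Gamma _.
rewrite (bigD1 i)//= [in RHS](bigD1 i)//= tnth_incr eqxx add1n.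
rewrite [X in _ * (_ * (_ * X)) = _](_ : _ = \prod_(j < k | j != i) (xi 0 j ^+ tnth x j / (tnth x j)`!%:R)); last first.
  by apply: eq_bigr => j /negbTE ji; rewrite tnth_incr ji.
rewrite exprS factS natrM.
have f0 : ((tnth x i)`!%:R : R) != 0 by rewrite pnatr_eq0 -lt0n fact_gt0.
have t0 : ((tnth x i).+1%:R : R) != 0 by rewrite pnatr_eq0.
have G0 : Gamma r != 0 by rewrite gt_eqF// Gamma_gt0.
(* The successor and the factorial become atoms for [field]. *)
move: (_.+1%:R) t0 => a t0; move: ((_`!)%:R) f0 => b f0.
by field; rewrite f0 t0 G0 !gt_eqF.
Qed.

(** Terms with x_i = 0 vanish and the others are reindexed by [incr_tnth]. The weight [h] is 1 for
    first moments and x_j for second moments. *)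
Lemma esum_tnth_negative_multinomial r xi i (h : k.-tuple nat -> R) :
  0 < r -> param_domain xi -> (forall x, 0 <= h x) ->
  (\esum_(x in setT) ((tnth x i)%:R * negative_multinomial r xi x * h x)%:E =
   (r * xi 0 i / prob xi 0 ord_max)%:E *
   \esum_(x in setT) (negative_multinomial (r + 1) xi x * h (incr_tnth i x))%:E)%E.
Proof.
move=> r0 Xi h0; have pn0 : 0 < prob xi 0 ord_max by exact: prob_gt0.
have [xi0 _] := Xi.
rewrite -esum_tuple_natZl; last 2 first.
- by rewrite divr_ge0 ?mulr_ge0// ltW.
- move=> x; rewrite lee_fin mulr_ge0// ltW// negative_multinomial_gt0//.
  by rewrite addr_gt0.
transitivity (\esum_(x in [set x : k.-tuple nat | (0 < tnth x i)%N])
    ((tnth x i)%:R * negative_multinomial r xi x * h x)%:E)%E.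
  rewrite [RHS]esum_mkcond; apply: eq_esum => x _.
  case: ifPn => // /negP; rewrite inE/= => /negP; rewrite -leqNgt leqn0 => /eqP ->.
  by rewrite !mul0r.
rewrite (@reindex_esum R _ _ _ _ _ _ (incr_tnth_bij i)).
apply: eq_esum => x _; rewrite negative_multinomial_incr// -EFinM.
by rewrite !mulrA.
Qed.

(** Integrability is bundled with the value because the expanded product of scores has terms of both
    signs. *)
Definition has_counting_integral (F : k.-tuple nat -> R) (c : R) : Prop :=
  (counting : {measure set _ -> \bar R}).-integrable setT (EFin \o F) /\
  (\int[counting]_x (F x)%:E = c%:E)%E.

Lemma ge0_has_counting_integral F c : (forall x, 0 <= F x) ->
  (\esum_(x in setT) (F x)%:E = c%:E)%E -> has_counting_integral F c.
Proof.
move=> F0 Fc.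
have intF : (\int[counting]_x (F x)%:E = c%:E)%E.
  by rewrite ge0_integral_counting_tuple_nat// => x; rewrite lee_fin.
split => //; apply/integrableP; split; first exact: measurable_fun_tuple_nat.
under eq_integral do rewrite /= ger0_norm//.
by rewrite intF ltry.
Qed.

Lemma has_counting_integralD F G a b :
  has_counting_integral F a -> has_counting_integral G b ->
  has_counting_integral (fun x => F x + G x) (a + b).
Proof.
move=> [iF Fa] [iG Gb]; split.
  exact: (integrableD measurableT iF iG).
under eq_integral do rewrite EFinD.
by rewrite (integralD measurableT iF iG) Fa Gb.
Qed.

Lemma has_counting_integralZ F a r : has_counting_integral F a ->
  has_counting_integral (fun x => r * F x) (r * a).
Proof.
move=> [iF Fa]; split; first exact: (integrableZl measurableT r iF).
under eq_integral do rewrite EFinM.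
by rewrite (integralZl measurableT iF r) Fa.
Qed.

Lemma negative_multinomial_moment1 r xi i : 0 < r -> param_domain xi ->
  has_counting_integral (fun x => (tnth x i)%:R * negative_multinomial r xi x)
    (r * xi 0 i / prob xi 0 ord_max).
Proof.
move=> r0 Xi; apply: ge0_has_counting_integral.
  by move=> x; rewrite mulr_ge0// ltW// negative_multinomial_gt0.
under eq_esum do rewrite -[X in X%:E]mulr1.
rewrite (@esum_tnth_negative_multinomial _ _ _ (fun=> 1))//.
under eq_esum do rewrite mulr1.
by rewrite esum_negative_multinomial ?mule1// addr_gt0.
Qed.

(** Shifting x_i turns the weight x_j into x_j + delta_ij, leaving a first moment and a total mass
    at parameter r + 1. *)
Lemma negative_multinomial_moment2 r xi i j : 0 < r -> param_domain xi ->
  has_counting_integral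
    (fun x => (tnth x i)%:R * negative_multinomial r xi x * (tnth x j)%:R)
    (r * xi 0 i / prob xi 0 ord_max *
     ((r + 1) * xi 0 j / prob xi 0 ord_max + (j == i)%:R)).
Proof.
move=> r0 Xi; apply: ge0_has_counting_integral.
  by move=> x; rewrite mulr_ge0// mulr_ge0// ltW// negative_multinomial_gt0.
have r10 : 0 < r + 1 by rewrite addr_gt0.
rewrite (@esum_tnth_negative_multinomial _ _ _ (fun x => (tnth x j)%:R))//.
rewrite [RHS]EFinM; congr (_ * _)%E.
transitivity (\esum_(x in [set: k.-tuple nat])
  ((((tnth x j)%:R * negative_multinomial (r + 1) xi x)%:E +
   ((j == i)%:R * negative_multinomial (r + 1) xi x)%:E)))%E.
  by apply: eq_esum => x _; rewrite tnth_incr natrD -EFinD; congr EFin; ring.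
have nm0 x : 0 <= negative_multinomial (r + 1) xi x.
  by rewrite ltW// negative_multinomial_gt0.
rewrite esumD; last 2 first.
- by move=> x _; rewrite lee_fin mulr_ge0.
- by move=> x _; rewrite lee_fin mulr_ge0.
have [im1 m1] := negative_multinomial_moment1 j r10 Xi.
rewrite -ge0_integral_counting_tuple_nat ?m1; last first.
  by move=> x; rewrite lee_fin mulr_ge0.
under eq_esum do rewrite EFinM.
by rewrite esum_tuple_natZl// esum_negative_multinomial// mule1 -EFinD.
Qed.

Lemma negative_multinomial_score_moment2 r xi i j :
  0 < r -> param_domain xi -> 
  has_counting_integral (fun x => negative_multinomial r xi x *
      ((tnth x i)%:R / xi 0 i - r / prob xi 0 ord_max) *
      ((tnth x j)%:R / xi 0 j - r / prob xi 0 ord_max))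
    (r / prob xi 0 ord_max *
     ((prob xi 0 ord_max)^-1 + (j == i)%:R / xi 0 i)).
Proof.
move=> r0 Xi; have pn0 : 0 < prob xi 0 ord_max by exact: prob_gt0.
have [xi0 _] := Xi; have xii0 := xi0 i; have xij0 := xi0 j.
set pn := prob xi 0 ord_max in pn0 *.
have h0 : has_counting_integral (negative_multinomial r xi) 1.
  apply: ge0_has_counting_integral; last exact: esum_negative_multinomial.
  by move=> x; rewrite ltW// negative_multinomial_gt0.
have m1 l := negative_multinomial_moment1 l r0 Xi.
have m2 := negative_multinomial_moment2 i j r0 Xi.
(* The product of scores expands into x_i x_j, constant, x_i and x_j terms. *)
have := has_counting_integralD
  (has_counting_integralD (has_counting_integralZ (xi 0 i * xi 0 j)^-1 m2)
    (has_counting_integralZ ((r / pn) ^+ 2) h0))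
  (has_counting_integralD (has_counting_integralZ (- (r / pn / xi 0 i)) (m1 i))
    (has_counting_integralZ (- (r / pn / xi 0 j)) (m1 j))).
congr has_counting_integral.
  by apply/funext => x; field; rewrite !gt_eqF.
by rewrite -/pn; case: eqP => [->|_] /=; field; rewrite !gt_eqF.
Qed.

End NegativeMultinomialMoments.

(** * Differential calculus *)

Section IsDiff.
Context {R : realType} {V W : normedModType R}.

Lemma is_diff_derive (f : V -> W) x df v : is_diff x f df -> 'D_v f x = df v.
Proof. by move=> [fx dfx]; rewrite deriveE// dfx. Qed.

(** The first-order expansion only sees the germ at [x]. This allows formulas that hold only on the
    open parameter domain. *)
Lemma is_diff_near_eq (f g : V -> W) x df :
  (\forall y \near x, f y = g y) -> is_diff x f df -> is_diff x g df.
Proof.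
move=> fg [fx dfx]; have /diff_locallyP[cdf fE] := fx.
have fgx : f x = g x := nbhs_singleton fg.
have gE : g \o shift x = cst (g x) + 'd f x +o_ 0 id.
  apply/eqaddoP => e e0; have /eqaddoP/(_ e e0) := fE; rewrite -fgx.
  have : \forall h \near (0 : V), f (h + x) = g (h + x).
    by move: fg; rewrite (near_shift (0 : V) x) /= subr0.
  by apply: filterS2 => h; rewrite /= !fctE/= => ->.
have dgE : 'd g x = 'd f x :> (V -> W) by exact: diff_unique.
by apply: DiffDef; [apply/diff_locallyP; rewrite dgE|rewrite dgE].
Qed.

Lemma is_diff_sumr (I : Type) (s : seq I) (f df : I -> V -> W) x :
  (forall i, is_diff x (f i) (df i)) ->
  is_diff x (fun y => \sum_(i <- s) f i y) (fun v => \sum_(i <- s) df i v).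
Proof.
move=> dfx; elim: s => [|i s IH].
  under eq_fun do rewrite big_nil; under [X in is_diff _ _ X]eq_fun do rewrite big_nil.
  exact: is_diff_cst.
under eq_fun do rewrite big_cons; under [X in is_diff _ _ X]eq_fun do rewrite big_cons.
exact: is_diffD.
Qed.

Lemma is_diff_comp1 (l dl : V -> R) (g : R -> R) dg x :
  is_diff x l dl -> is_derive (l x) 1 g dg ->
  is_diff x (g \o l) (fun v => dg * dl v).
Proof.
move=> [lx dlx] [gx gE].
have gd : differentiable g (l x) by exact/derivable1_diffP.
apply: DiffDef; first exact: differentiable_comp.
rewrite diff_comp// dlx diff1E//; apply/funext => v /=.
by rewrite derive1E gE mulrC.
Qed.

Lemma is_diff_mulrl (c : R) (l dl : V -> R) x :
  is_diff x l dl -> is_diff x (fun y => c * l y) (fun v => c * dl v).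
Proof. by move=> lx; exact: (is_diffZ c lx). Qed.

End IsDiff.

Section IsDiffRow.
Context {R : realType} {V : normedModType R} {m : nat}.

Lemma is_diff_row (f df : 'I_m -> V -> R) x :
  (forall i, is_diff x (f i) (df i)) ->
  is_diff x (fun y => \row_i f i y) (fun v => \row_i df i v).
Proof.
move=> dfx.
have rowE (h : 'I_m -> V -> R) :
    (fun y => \row_i h i y) = fun y => \sum_i h i y *: delta_mx 0 i.
  apply/funext => y; rewrite [LHS]row_sum_delta.
  by apply: eq_bigr => i _; rewrite mxE.
rewrite !rowE; apply: is_diff_sumr => i.
by have [fx dE] := dfx i; apply: DiffDef; [exact: differentiableZl|rewrite diffZl// dE].
Qed.

(** A coordinate is a continuous linear map, hence its own differential. *)
Lemma is_diff_coord n (x : 'rV[R]_n) (i : 'I_n) :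
  is_diff x (fun y : 'rV[R]_n => y 0 i) (fun v => v 0 i).
Proof.
have @f : {linear 'rV[R]_n -> R}.
  by exists (fun N : 'rV[R]_n => N 0 i); do 2![eexists]; do ?[constructor];
     rewrite ?mxE// => ? *; rewrite ?mxE//; move=> ?; rewrite !mxE.
rewrite -[X in is_diff _ X _]/(f : _ -> _) -[X in is_diff _ _ X]/(f : _ -> _).
apply: DiffDef; first exact/linear_differentiable/coord_continuous.
by rewrite diff_lin//; exact: coord_continuous.
Qed.

(* The row functions c_i * G n i (l_i y) form a class which is stable under
   directional derivatives as soon as the l_i are affine. *)
Lemma smooth_on_open_row (U : set V) (l : 'I_m -> V -> R)
    (dl : 'I_m -> V -> R) (G : nat -> 'I_m -> R -> R) :
  open U -> (forall i x, U x -> is_diff x (l i) (dl i)) ->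
  (forall n i x, U x -> is_derive (l i x) 1 (G n i) (G n.+1 i (l i x))) ->
  smooth_on_open U (fun x => \row_i G 0%N i (l i x)).
Proof.
move=> oU dlU dG.
(* Here [n] counts the derivatives already taken and [c] collects the factors [dl i v] they
   produced. The formula for [h] is required on [U] only, where derivatives are known. *)
suff gen (s : seq V) n (c : 'I_m -> R) (h : V -> 'rV[R]_m) x :
    (forall x, U x -> h x = \row_i (c i * G n i (l i x))) -> U x ->
    differentiable (iter_derive s h) x.
  move=> s x; apply: (gen s 0 (fun=> 1)) => y _.
  by apply/rowP => i; rewrite !mxE mul1r.
elim: s n c h x => [|v s IH] n c h x hE Ux /=.
all: have hx y : U y -> is_diff y h (fun v => \row_i (c i * (G n.+1 i (l i y) * dl i v))).
1,3: move=> Uy; apply: (@is_diff_near_eq _ _ _ (fun y => \row_i (c i * G n i (l i y)))).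
1,3: by near=> z; rewrite hE//; near: z; exact: open_nbhs_nbhs.
1,2: apply: is_diff_row => i; apply: is_diff_mulrl; apply: is_diff_comp1; [exact: dlU|exact: dG].
  by have [] := hx x Ux.
apply: (IH n.+1 (fun i => c i * dl i v)) => // y Uy.
rewrite (is_diff_derive v (hx y Uy)).
by apply/rowP => i; rewrite !mxE; ring.
Unshelve. all: by end_near. Qed.

End IsDiffRow.

(** * Differential and injectivity of the parametrisation *)

Section NegativeMultinomialDerivative.
Context {R : realType} {k : nat}.
Implicit Types (xi v : 'rV[R]_k) (x : k.-tuple nat) (r : R).

(** The linear part of the affine map [prob]. *)
Definition dprob v : 'rV[R]_k.+1 :=
  \row_i if unlift ord_max i is Some j then v 0 j else - \sum_j v 0 j.

Lemma dprob_max v : dprob v 0 ord_max = - \sum_j v 0 j.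
Proof. by rewrite mxE unlift_none. Qed.

Lemma dprob_lift v j : dprob v 0 (lift ord_max j) = v 0 j.
Proof. by rewrite mxE liftK. Qed.

Lemma is_diff_prob xi i :
  is_diff xi (fun xi' => prob xi' 0 i) (fun v => dprob v 0 i).
Proof.
have [j|] := unliftP ord_max i => ->.
  under eq_fun do rewrite prob_lift; under [X in is_diff _ _ X]eq_fun do rewrite dprob_lift.
  exact: is_diff_coord.
under eq_fun do rewrite prob_max; under [X in is_diff _ _ X]eq_fun do rewrite dprob_max.
rewrite [X in is_diff _ _ X](_ : _ = (fun=> 0) - (fun v => \sum_j v 0 j)); last first.
  by apply/funext => v; rewrite !fctE sub0r.
apply: is_diffB; apply: is_diff_sumr => j; exact: is_diff_coord.
Qed.

Lemma param_domainE xi : param_domain xi <-> forall i, 0 < prob xi 0 i.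
Proof.
split=> [Xi i|xi0]; first exact: prob_gt0.
split=> [i|]; first by rewrite -prob_lift.
by rewrite -subr_gt0 -prob_max.
Qed.

(** The domain is cut out by positivity of finitely many continuous functions. *)
Lemma open_param_domain : open (@param_domain R k).
Proof.
rewrite openE => xi /param_domainE xi0.
rewrite /interior; near=> xi'; apply/param_domainE.
near: xi'; apply: filter_forall => i.
apply: (@cvgr_gt _ _ _ _ (fun xi' => prob xi' 0 i)); last exact: xi0.
apply: differentiable_continuous.
by have [] := is_diff_prob xi i.
Unshelve. all: by end_near. Qed.

Lemma near_param_domain xi : param_domain xi ->
  \forall xi' \near xi, param_domain xi'.
Proof. by move=> Xi; apply: open_nbhs_nbhs; split => //; exact: open_param_domain. Qed.

(** Treating [r] as one more exponent makes the log-mass linear in the ln p_i, up to the constant ln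
    [nm_const]. *)
Definition nm_exponent r x (i : 'I_k.+1) : R :=
  if unlift ord_max i is Some j then (tnth x j)%:R else r.

Definition nm_const r x : R :=
  Gamma (\sum_i (tnth x i)%:R + r) / Gamma r * \prod_i ((tnth x i)`!%:R)^-1.

Lemma nm_const_gt0 r x : 0 < r -> 0 < nm_const r x.
Proof.
move=> r0; rewrite !mulr_gt0 ?invr_gt0 ?Gamma_gt0//.
  by rewrite ltr_wpDl// sumr_ge0.
by apply: prodr_gt0 => i _; rewrite invr_gt0 ltr0n fact_gt0.
Qed.

Lemma negative_multinomialE r xi x : param_domain xi ->
  negative_multinomial r xi x =
  nm_const r x * expR (\sum_i nm_exponent r x i * ln (prob xi 0 i)).
Proof.
move=> Xi; have [xi0 _] := Xi; have pn0 := prob_gt0 ord_max Xi.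
rewrite sum_ord_lift_max expRD expR_sum.
rewrite {1}/nm_exponent unlift_none mulrC [r * _]mulrC expRM lnK ?posrE//.
rewrite (eq_bigr (fun j => xi 0 j ^+ tnth x j)); last first.
  move=> j _; rewrite /nm_exponent liftK prob_lift expRM_natl lnK// posrE; exact: xi0.
by rewrite /negative_multinomial /nm_const big_split/=; ring.
Qed.

Lemma ln_negative_multinomial r xi x : 0 < r -> param_domain xi ->
  ln (negative_multinomial r xi x) =
  ln (nm_const r x) + \sum_i nm_exponent r x i * ln (prob xi 0 i).
Proof.
move=> r0 Xi; rewrite negative_multinomialE//.
by rewrite lnM ?posrE ?expR_gt0 ?nm_const_gt0// expRK.
Qed.

Definition dln_nm r x xi v : R :=
  \sum_i nm_exponent r x i * ((prob xi 0 i)^-1 * dprob v 0 i).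

Lemma is_diff_ln_negative_multinomial r xi x : 0 < r -> param_domain xi ->
  is_diff xi (fun xi' => ln (negative_multinomial r xi' x)) (dln_nm r x xi).
Proof.
move=> r0 Xi.
apply: (@is_diff_near_eq _ _ _ (fun xi' =>
    ln (nm_const r x) + \sum_i nm_exponent r x i * ln (prob xi' 0 i))).
  near=> xi'; rewrite ln_negative_multinomial//.
  by near: xi'; exact: near_param_domain.
rewrite (_ : dln_nm r x xi = (fun=> 0) + dln_nm r x xi); last first.
  by apply/funext => v; rewrite !fctE add0r.
apply: is_diffD; apply: is_diff_sumr => i; apply: is_diff_mulrl.
apply: (@is_diff_comp1 _ _ (fun xi' => prob xi' 0 i) _ (@ln R));
  first exact: is_diff_prob.
by apply: is_derive1_ln; exact: prob_gt0.
Unshelve. all: by end_near. Qed.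

(** Near [xi] the mass is the exponential of its logarithm, so the chain rule applies. *)
Lemma is_diff_negative_multinomial r xi x : 0 < r -> param_domain xi ->
  is_diff xi (fun xi' => negative_multinomial r xi' x)
    (fun v => negative_multinomial r xi x * dln_nm r x xi v).
Proof.
move=> r0 Xi.
apply: (@is_diff_near_eq _ _ _ (expR \o fun xi' => ln (negative_multinomial r xi' x))).
  near=> xi'; rewrite /= lnK// posrE negative_multinomial_gt0//.
  by near: xi'; exact: near_param_domain.
apply: is_diff_comp1; first exact: is_diff_ln_negative_multinomial.
rewrite -[X in is_derive _ _ _ X]lnK ?posrE ?negative_multinomial_gt0//.
exact: is_derive_expR.
Unshelve. all: by end_near. Qed.

Lemma dln_nmE r x xi v : dln_nm r x xi v =
  \sum_j (tnth x j)%:R / xi 0 j * v 0 j - r / prob xi 0 ord_max * \sum_j v 0 j.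
Proof.
rewrite /dln_nm sum_ord_lift_max {1}/nm_exponent unlift_none dprob_max.
rewrite addrC mulrN mulrN mulrA; congr (_ - _).
by apply: eq_bigr => j _; rewrite /nm_exponent liftK prob_lift dprob_lift mulrA.
Qed.

Let zero_tuple : k.-tuple nat := [tuple 0%N | _ < k].

Lemma tnth_zero_tuple j : tnth zero_tuple j = 0%N.
Proof. by rewrite tnth_mktuple. Qed.

(** Two kinds of test points suffice: x = 0 equates the terms in r / p_n, and then x = e_i equates
    v_i / xi^i with w_i / xi^i. *)
Lemma dln_nm_inj r xi v w : 0 < r -> param_domain xi ->
  (forall x, dln_nm r x xi v = dln_nm r x xi w) -> v = w.
Proof.
move=> r0 Xi; have [xi0 _] := Xi => vw.
have vw0 := vw zero_tuple; rewrite !dln_nmE in vw0.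
have sum0 (u : 'rV[R]_k) : \sum_j (tnth zero_tuple j)%:R / xi 0 j * u 0 j = 0.
  by rewrite big1// => j _; rewrite tnth_zero_tuple !mul0r.
rewrite !sum0 !sub0r in vw0; have {}vw0 := oppr_inj vw0.
apply/rowP => i; have := vw (incr_tnth i zero_tuple); rewrite !dln_nmE vw0 => /addIr.
have sum1 (u : 'rV[R]_k) :
    \sum_j (tnth (incr_tnth i zero_tuple) j)%:R / xi 0 j * u 0 j = (xi 0 i)^-1 * u 0 i.
  rewrite (bigD1 i)//= big1 ?addr0 => [|j /negbTE ji].
    by rewrite tnth_incr tnth_zero_tuple eqxx mul1r.
  by rewrite tnth_incr tnth_zero_tuple ji !mul0r.
by rewrite !sum1; apply: mulfI; rewrite invr_eq0 gt_eqF.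
Qed.

(** The same test points applied to the log-mass, whose constant does not depend on the parameter: x
    = 0 equates the terms r ln p_n, and x = e_i then equates the ln xi^i. *)
Lemma negative_multinomial_inj r : 0 < r ->
  set_inj (@param_domain R k) (negative_multinomial r).
Proof.
move=> r0 xi xi' /set_mem Xi /set_mem Xi' nmE.
have lnE x : \sum_i nm_exponent r x i * ln (prob xi 0 i) =
             \sum_i nm_exponent r x i * ln (prob xi' 0 i).
  have := congr1 (fun h : k.-tuple nat -> R => ln (h x)) nmE.
  by rewrite !ln_negative_multinomial// => /addrI.
have expE x : \sum_j (tnth x j)%:R * ln (xi 0 j) + r * ln (prob xi 0 ord_max) =
              \sum_j (tnth x j)%:R * ln (xi' 0 j) + r * ln (prob xi' 0 ord_max).
  have := lnE x; rewrite !sum_ord_lift_max /nm_exponent unlift_none.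
  under eq_bigr do rewrite liftK prob_lift.
  under [X in _ = _ + X -> _]eq_bigr do rewrite liftK prob_lift.
  by rewrite addrC [RHS]addrC.
have sum0 (u : 'rV[R]_k) : \sum_j (tnth zero_tuple j)%:R * ln (u 0 j) = 0.
  by rewrite big1// => j _; rewrite tnth_zero_tuple mul0r.
have := expE zero_tuple; rewrite !sum0 !add0r => max_eq.
apply/rowP => i.
have := expE (incr_tnth i zero_tuple); rewrite max_eq => /addIr.
have sum1 (u : 'rV[R]_k) :
    \sum_j (tnth (incr_tnth i zero_tuple) j)%:R * ln (u 0 j) = ln (u 0 i).
  rewrite (bigD1 i)//= big1 ?addr0 => [|j /negbTE ji].
    by rewrite tnth_incr tnth_zero_tuple eqxx mul1r.
  by rewrite tnth_incr tnth_zero_tuple ji mul0r.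
by rewrite !sum1; apply: ln_inj; rewrite posrE; [case: Xi|case: Xi'].
Qed.

End NegativeMultinomialDerivative.

(** * The isometry with the sphere *)

Section SphereMap.
Context {R : realType} {k : nat}.
Implicit Types (xi v : 'rV[R]_k).

Definition sphere_map xi : 'rV[R]_k.+1 := \row_i (2 * Num.sqrt (prob xi 0 i)).

(** Being polynomial, this inverse extends smoothly to the whole space. *)
Definition sphere_inv (y : 'rV[R]_k.+1) : 'rV[R]_k :=
  \row_j (y 0 (lift ord_max j) ^+ 2 / 4).

Lemma sqr_sphere_map xi i : param_domain xi ->
  sphere_map xi 0 i ^+ 2 = 4 * prob xi 0 i.
Proof.
move=> Xi; rewrite mxE exprMn sqr_sqrtr ?ltW ?prob_gt0//; congr (_ * _); ring.
Qed.

Lemma sum_prob xi : \sum_i prob xi 0 i = 1.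
Proof.
rewrite sum_ord_lift_max; under eq_bigr do rewrite prob_lift.
by rewrite prob_max subrK.
Qed.

Lemma sphere_mapP xi : param_domain xi -> positive_sphere2 (sphere_map xi).
Proof.
move=> Xi; split=> [i|].
  by rewrite mxE mulr_gt0// sqrtr_gt0 prob_gt0.
under eq_bigr do rewrite sqr_sphere_map//.
by rewrite -mulr_sumr sum_prob mulr1.
Qed.

Lemma sphere_mapK xi : param_domain xi -> sphere_inv (sphere_map xi) = xi.
Proof.
move=> Xi; apply/rowP => j; rewrite mxE sqr_sphere_map// prob_lift.
by rewrite mulrC mulKf.
Qed.

(** For the last index this is the equation of the sphere divided by 4. *)
Lemma prob_sphere_inv y i : positive_sphere2 y ->
  prob (sphere_inv y) 0 i = y 0 i ^+ 2 / 4.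
Proof.
move=> [y0 y4]; have [j|] := unliftP ord_max i => ->.
  by rewrite prob_lift mxE.
rewrite prob_max; under eq_bigr do rewrite mxE.
rewrite -mulr_suml; move: y4; rewrite sum_ord_lift_max => /(canRL (addrK _)) ->.
by field.
Qed.

Lemma sphere_invP y : positive_sphere2 y -> param_domain (sphere_inv y).
Proof.
move=> Sy; apply/param_domainE => i; rewrite prob_sphere_inv//.
by rewrite divr_gt0// exprn_gt0//; case: Sy.
Qed.

Lemma sphere_invK y : positive_sphere2 y -> sphere_map (sphere_inv y) = y.
Proof.
move=> Sy; have [y0 _] := Sy; apply/rowP => i; rewrite mxE prob_sphere_inv//.
have -> : y 0 i ^+ 2 / 4 = (y 0 i / 2) ^+ 2 by field.
rewrite sqrtr_sqr ger0_norm; first by field.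
by rewrite divr_ge0// ltW.
Qed.

Lemma is_derive_mulrl (c t dg : R) (g : R -> R) :
  is_derive t 1 g dg -> is_derive t 1 (fun s => c * g s) (c * dg).
Proof. by move=> dgt; exact: is_deriveZ. Qed.

Lemma smooth_sphere_map : exists h : 'rV[R]_k -> 'rV[R]_k.+1,
  smooth_on_open (@param_domain R k) h /\
  forall xi, param_domain xi -> h xi = sphere_map xi.
Proof.
(* The n-th derivative of 2 t^(1/2); the product is the falling factorial of 1/2. Real power and
   square root are compared only where p_i > 0. *)
pose G (n : nat) (_ : 'I_k.+1) (t : R) :=
  2 * \prod_(m < n) (2^-1 - m%:R) * t `^ (2^-1 - n%:R).
exists (fun xi => \row_i G 0%N i (prob xi 0 i)); split.
  apply: (@smooth_on_open_row _ _ _ _ (fun i xi => prob xi 0 i) (fun i v => dprob v 0 i) G).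
  - exact: open_param_domain.
  - by move=> i xi _; exact: is_diff_prob.
  - move=> n i xi Xi; have p0 := prob_gt0 i Xi.
    rewrite /G big_ord_recr/=.
    apply: is_derive_eq; first exact/is_derive_mulrl/is_derive1_powR.
    by rewrite -[n.+1%:R]natr1 opprD addrA !mulrA.
move=> xi Xi; apply/rowP => i; rewrite [LHS]mxE [RHS]mxE /G big_ord0 mulr1 subr0.
by rewrite powR12_sqrt// ltW// prob_gt0.
Qed.

Lemma smooth_sphere_inv : smooth_on_open setT sphere_inv.
Proof.
(* The successive derivatives of t^2 / 4. *)
pose G (n : nat) (_ : 'I_k) (t : R) : R :=
  match n with 0 => t ^+ 2 / 4 | 1 => t / 2 | 2 => 2^-1 | _ => 0 end.
have -> : sphere_inv = fun y => \row_i G 0%N i (y 0 (lift ord_max i)) by [].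
apply: (@smooth_on_open_row R 'rV[R]_k.+1 k setT (fun i y => y 0 (lift ord_max i))
  (fun i w => w 0 (lift ord_max i)) G).
- exact: openT.
- by move=> i xi _; exact: is_diff_coord.
- move=> [|[|[|n]]] i y _ /=; set t := y 0 _.
  + rewrite (_ : G 0%N i = fun s => 4^-1 * s ^+ 2); last first.
      by apply/funext => s; rewrite /G mulrC.
    by apply: is_derive_eq; rewrite /GRing.scale/=; field.
  + rewrite (_ : G 1%N i = fun s => 2^-1 * s); last first.
      by apply/funext => s; rewrite /G mulrC.
    by apply: is_derive_eq; rewrite /GRing.scale/= mulr1.
  + exact: is_derive_cst.
  + exact: is_derive_cst.
Qed.

(** The factor 2 of the map cancels the 1/2 from the derivative of the square root. *)
Lemma is_diff_sphere_map xi : param_domain xi ->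
  is_diff xi sphere_map (fun v => \row_i (dprob v 0 i / Num.sqrt (prob xi 0 i))).
Proof.
move=> Xi.
rewrite (_ : (fun v => _) =
    fun v => \row_i ((Num.sqrt (prob xi 0 i))^-1 * dprob v 0 i)); last first.
  by apply/funext => v; apply/rowP => i; rewrite !mxE mulrC.
apply: (@is_diff_row _ _ _ (fun i xi' => 2 * Num.sqrt (prob xi' 0 i))
  (fun i v => (Num.sqrt (prob xi 0 i))^-1 * dprob v 0 i)) => i.
apply: (@is_diff_comp1 _ _ (fun xi' => prob xi' 0 i) _ (fun t => 2 * Num.sqrt t)).
  exact: is_diff_prob.
have p0 := prob_gt0 i Xi.
apply: is_derive_eq; first exact/is_derive_mulrl/is_derive1_sqrt.
by field; rewrite gt_eqF// sqrtr_gt0.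
Qed.

End SphereMap.

(** * The Fisher metric and its comparison with the hyperbolic metric *)

Section FisherMetric.
Context {R : realType} {k : nat}.
Context (r : R) (r0 : 0 < r).
Implicit Types (xi v : 'rV[R]_k) (x : k.-tuple nat).
Local Notation phi := (negative_multinomial r).
Local Notation Xi := (@param_domain R k).
Local Notation mu := (counting : {measure set (k.-tuple nat) -> \bar R}).

Lemma dparam_negative_multinomial xi v x : Xi xi ->
  dparam phi xi v x = phi xi x * dln_nm r x xi v.
Proof.
move=> Xxi; rewrite /dparam.
by have [_ ->] := is_diff_negative_multinomial x r0 Xxi.
Qed.

(** Dividing by the positive mass reduces this to [dln_nm_inj]. *)
Lemma dparam_negative_multinomial_inj xi : Xi xi -> injective (dparam phi xi).
Proof.
move=> Xxi v w vw; apply: (dln_nm_inj r0 Xxi) => x.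
have := congr1 (fun u : k.-tuple nat -> R => u x) vw.
rewrite /= !dparam_negative_multinomial//; apply: mulfI.
by rewrite gt_eqF// negative_multinomial_gt0.
Qed.

Lemma score_negative_multinomial xi i x : Xi xi ->
  score phi xi i x = (tnth x i)%:R / xi 0 i - r / prob xi 0 ord_max.
Proof.
move=> Xxi; rewrite /score.
rewrite (is_diff_derive _ (is_diff_ln_negative_multinomial x r0 Xxi)) dln_nmE.
have deltaE j : delta_mx 0 i 0 j = (j == i)%:R :> R by rewrite mxE eqxx.
under eq_bigr do rewrite deltaE.
under [X in _ * X]eq_bigr do rewrite deltaE.
rewrite (bigD1 i)//= eqxx big1 => [|j /negbTE ->]; last by rewrite mulr0.
rewrite (bigD1 i)//= eqxx big1 => [|j /negbTE -> //].
by rewrite !addr0 !mulr1.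
Qed.

Lemma has_counting_integral_fisher xi i j : Xi xi ->
  has_counting_integral (fisher_integrand phi xi i j)
    (r / prob xi 0 ord_max *
     ((prob xi 0 ord_max)^-1 + (j == i)%:R / xi 0 i)).
Proof.
move=> Xxi; have := negative_multinomial_score_moment2 i j r0 Xxi.
congr has_counting_integral; apply/funext => x.
by rewrite /fisher_integrand !score_negative_multinomial.
Qed.

Lemma stat_parametrisation_negative_multinomial :
  stat_parametrisation mu Xi phi.
Proof.
split.
- exact: open_param_domain.
- by move=> xi x; exact: negative_multinomial_gt0.
- move=> xi Xxi; rewrite ge0_integral_counting_tuple_nat ?esum_negative_multinomial//.
  by move=> x; rewrite lee_fin ltW// negative_multinomial_gt0.
- exact: negative_multinomial_inj.
- by move=> xi x Xxi; have [] := is_diff_negative_multinomial x r0 Xxi.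
- exact: dparam_negative_multinomial_inj.
- by move=> xi i j /(has_counting_integral_fisher i j)[].
Qed.

(** The constant part 1 / p_n of the matrix yields (sum v)(sum w) / p_n, the last term of the
    right-hand sum since the signs in [dprob] cancel; the diagonal part yields the other terms. *)
Lemma fisher_formE xi v w : Xi xi ->
  (v *m fisher_matrix mu phi xi *m w^T) 0 0 =
  r / prob xi 0 ord_max *
  \sum_i dprob v 0 i * dprob w 0 i / prob xi 0 i.
Proof.
move=> Xxi; rewrite mxE.
have pn0 : prob xi 0 ord_max != 0 by rewrite gt_eqF// prob_gt0.
have colE j : (v *m fisher_matrix mu phi xi) 0 j =
    r / prob xi 0 ord_max *
    ((\sum_i v 0 i) / prob xi 0 ord_max + v 0 j / xi 0 j).
  rewrite mxE.
  transitivity (\sum_i (r / prob xi 0 ord_max * (v 0 i / prob xi 0 ord_max) +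
      r / prob xi 0 ord_max * ((j == i)%:R * (v 0 i / xi 0 i)))).
    apply: eq_bigr => i _; rewrite mxE /Rintegral.
    by have [_ ->] := has_counting_integral_fisher i j Xxi; rewrite /=; ring.
  rewrite big_split/= -!mulr_sumr -mulrDr -mulr_suml; congr (_ * (_ + _)).
  rewrite (bigD1 j)//= eqxx mul1r big1 ?addr0// => i.
  by rewrite eq_sym => /negbTE ->; rewrite mul0r.
under eq_bigr do rewrite colE [w^T _ _]mxE -mulrA.
rewrite -mulr_sumr; congr (_ * _).
rewrite sum_ord_lift_max !dprob_max mulrNN.
under eq_bigr do rewrite mulrDl.
rewrite big_split/= -mulr_sumr; congr (_ + _); first by field.
by apply: eq_bigr => j _; rewrite !dprob_lift prob_lift mulrAC.
Qed.

Lemma chartK xi : Xi xi -> chart Xi phi (phi xi) = xi.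
Proof.
move=> Xxi; apply: pinvKV; last exact/mem_set.
exact: negative_multinomial_inj.
Qed.

Lemma tangent_coordK xi v : Xi xi ->
  tangent_coord Xi phi (phi xi) (dparam phi xi v) = v.
Proof.
move=> Xxi; rewrite /tangent_coord chartK//; apply: pinvKV; last exact/mem_set.
by move=> ? ? _ _; exact: dparam_negative_multinomial_inj.
Qed.

Context (f : (k.-tuple nat -> R) -> 'rV[R]_k.+1)
  (fE : forall xi, Xi xi -> f (phi xi) = sphere_map xi).

Lemma diffeomorphism_sphere : diffeomorphism_onto Xi phi f positive_sphere2.
Proof.
split.
- split.
  + by move=> _ [xi Xxi <-]; rewrite fE//; exact: sphere_mapP.
  + move=> _ _ /set_mem[xi Xxi <-] /set_mem[xi' Xxi' <-].
    rewrite !fE// => /(congr1 sphere_inv).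
    by rewrite !sphere_mapK// => ->.
  + move=> y Sy; exists (phi (sphere_inv y)).
      by exists (sphere_inv y) => //; exact: sphere_invP.
    by rewrite fE ?sphere_invK//; exact: sphere_invP.
- have [h [sh hE]] := @smooth_sphere_map R k.
  move=> xi Xxi; exists Xi, h; split => //; first exact: open_param_domain.
  by move=> z Xz _; rewrite /= fE// hE.
- exists sphere_inv; split; last by move=> xi Xxi; rewrite fE// sphere_mapK.
  (* One global extension serves at every point of the sphere. *)
  move=> y _; exists setT, sphere_inv; split => //; first exact: openT.
  exact: smooth_sphere_inv.
Qed.

(** The values of [f] are prescribed on the manifold only, but [f \o phi] equals [sphere_map] on a
    neighbourhood of [xi], which determines the differential. *)
Lemma tangent_mapE xi v : Xi xi ->
  tangent_map Xi phi f (phi xi) (dparam phi xi v) =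
  \row_i (dprob v 0 i / Num.sqrt (prob xi 0 i)).
Proof.
move=> Xxi; rewrite /tangent_map tangent_coordK// chartK//.
suff [_ ->] : is_diff xi (f \o phi)
    (fun v => \row_i (dprob v 0 i / Num.sqrt (prob xi 0 i))) by [].
apply: is_diff_near_eq (is_diff_sphere_map Xxi).
near=> xi'; rewrite /= fE//; near: xi'; exact: near_param_domain.
Unshelve. all: by end_near. Qed.

(** Both sides reduce to r / p_n times the sum of [dprob a] [dprob b] / p_i: on the right, y_n^2 = 4
    p_n absorbs the 4, and the two square roots multiply to p_i. *)
Lemma fisher_metric_hyperbolic (q u v : k.-tuple nat -> R) : stat_manifold Xi phi q ->
  tangent_space Xi phi q u -> tangent_space Xi phi q v ->
  fisher_metric mu Xi phi q u v =
  4 * r * hyperbolic_metric (f q) (tangent_map Xi phi f q u)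
                                  (tangent_map Xi phi f q v).
Proof.
move=> [xi Xxi <-]; rewrite /tangent_space chartK// => -[a _ <-] [b _ <-].
rewrite /fisher_metric !tangent_coordK// chartK// fisher_formE//.
rewrite !tangent_mapE// /hyperbolic_metric fE// sqr_sphere_map//.
have pn0 : prob xi 0 ord_max != 0 by rewrite gt_eqF// prob_gt0.
rewrite [in RHS](eq_bigr (fun i => dprob a 0 i * dprob b 0 i / prob xi 0 i)); last first.
  move=> i _; have p0 := prob_gt0 i Xxi.
  have rowE c : (\row_j (dprob c 0 j / Num.sqrt (prob xi 0 j))) 0 i =
      dprob c 0 i / Num.sqrt (prob xi 0 i) by rewrite [LHS]mxE.
  by rewrite !rowE mulrACA -invfM -expr2 sqr_sqrtr// ltW.
by field.
Qed.

End FisherMetric.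

Theorem mainTheorem1 (R : realType) (k : nat) (hk : (2 <= k.+1)%N)
    (xn : R) (hxn : 0 < xn) :
  let mu : {measure set (k.-tuple nat) -> \bar R} := counting in
  let Xi : set 'rV[R]_k := param_domain in
  let phi : 'rV[R]_k -> k.-tuple nat -> R := negative_multinomial xn in
  stat_parametrisation mu Xi phi /\
  forall f : (k.-tuple nat -> R) -> 'rV[R]_k.+1,
    (forall xi, Xi xi -> f (phi xi) = \row_i (2 * Num.sqrt (prob xi 0 i))) ->
    diffeomorphism_onto Xi phi f positive_sphere2 /\
    forall q u v : k.-tuple nat -> R,
      stat_manifold Xi phi q ->
      tangent_space Xi phi q u -> tangent_space Xi phi q v ->
      fisher_metric mu Xi phi q u v =
      4 * xn * hyperbolic_metric (f q) (tangent_map Xi phi f q u)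
                                       (tangent_map Xi phi f q v).
Proof.
move=> mu Xi phi; split; first exact: stat_parametrisation_negative_multinomial.
move=> f fE; split; first exact: diffeomorphism_sphere.
exact: fisher_metric_hyperbolic.
Qed.
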